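(* Endow $[0,1]$ with the metric $|x-y|$. The map $\mathrm{mdim}_M: C^0([0,1])\to\mathbb{R}$, $\phi\mapsto \mathrm{mdim}_M([0,1],\phi,|\cdot|)$, is not continuous anywhere; that is, it is discontinuous at every $\phi\in C^0([0,1])$. (This is asserted both for the lower metric mean dimension $\underline{\mathrm{mdim}_M}$ and for the upper metric mean dimension $\overline{\mathrm{mdim}_M}$.)
   Context: For a compact metric space $(X,d)$, $C^0(X)$ is the set of continuous maps $X\to X$ with the uniform metric $d(\phi,\varphi)=\max_{x\in X}d(\phi(x),\varphi(x))$. For $\phi\in C^0(X)$ and $n\ge1$ let $d_n(x,y)=\max_{0\le j\le n-1}d(\phi^j(x),\phi^j(y))$. A set $A\subset X$ is $(n,\phi,\varepsilon)$-separated if $d_n(x,y)>\varepsilon$ for all distinct $x,y\in A$; $\mathrm{sep}(n,\phi,\varepsilon)$ is the maximal cardinality of such a set, and $\mathrm{sep}(\phi,\varepsilon)=\limsup_{n\to\infty}\frac1n\log \mathrm{sep}(n,\phi,\varepsilon)$. The lower and upper metric mean dimensions are $$\underline{\mathrm{mdim}_M}(X,\phi,d)=\liminf_{\varepsilon\to0}\frac{\mathrm{sep}(\phi,\varepsilon)}{|\log\varepsilon|},\qquad \overline{\mathrm{mdim}_M}(X,\phi,d)=\limsup_{\varepsilon\to0}\frac{\mathrm{sep}(\phi,\varepsilon)}{|\log\varepsilon|}.$$ The symbol $\mathrm{mdim}_M$ without underline or overline means that the assertion holds for each of the two. For $X=[0,1]$ with the metric $|x-y|$ both take values in $[0,1]$.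 *)

(* Defs.v *)
From HB Require Import structures.
From mathcomp Require Import all_boot all_order all_algebra finmap.
From mathcomp Require Import all_classical all_reals all_analysis.

Set Implicit Arguments.
Unset Strict Implicit.
Unset Printing Implicit Defensive.

Import Order.TTheory GRing.Theory Num.Theory.
Import numFieldNormedType.Exports.

Local Open Scope classical_set_scope.
Local Open Scope ring_scope.

Section metric_mean_dimension.
Context {R : realType} {X : metricType R}.
Implicit Types (phi : X -> X) (n : nat) (e : R).

(* Distances are nonnegative, so the base value 0 of the iterated maximum is
   harmless as soon as n >= 1. *)
Definition bowen_dist phi n (x y : X) : R :=
  \big[Num.max/0]_(j < n) mdist (iter j phi x) (iter j phi y).

Definition bowen_separated n phi e (A : {fset X}) : Prop :=
  forall x y, x \in A -> y \in A -> x <> y -> e < bowen_dist phi n x y.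

(* On a compact space every separated set is finite and the supremum is an
   attained natural number. *)
Definition sep_card n phi e : \bar R :=
  ereal_sup [set (#|` A|%:R)%:E | A in bowen_separated n phi e].

Definition sep phi e : \bar R :=
  limn_esup (fun n => (n%:R^-1)%:E * lne (sep_card n phi e))%E.

Definition lower_mdim phi : \bar R :=
  limf_einf (fun e : R => sep phi e * (`|ln e|^-1)%:E)%E 0^'+.

Definition upper_mdim phi : \bar R :=
  limf_esup (fun e : R => sep phi e * (`|ln e|^-1)%:E)%E 0^'+.

End metric_mean_dimension.

(* The compactness proof makes the supremum below finite, which is what turns
   it into a metric. *)
Definition C0 (R : realType) (X : metricType R) (cX : compact [set: X]) : Type :=
  continuousType X X.

Section uniform_metric.
Context {R : realType} {X : metricType R} (cX : compact [set: X]).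
Implicit Types f g h : C0 cX.

Definition unif_dist f g : R := sup [set mdist (f x) (g x) | x in [set: X]].

Lemma compact_mdist_bounded : exists M : R, forall x y : X, mdist x y <= M.
Proof.
have [[x0]|noX] := pselect (inhabited X); last first.
  by exists 0 => x; exfalso; apply: noX; exists.
have /compact_near_coveringP cov := cX.
have [x _|M [Mreal MP]] :=
  cov R +oo (fun M x => mdist x0 x <= M) _.
  exists (ball x 1, [set M | mdist x0 x + 1 < M]).
    split => /=; first exact: nbhsx_ballx.
    by exists (mdist x0 x + 1); split => //; exact: num_real.
  move=> [y M] /= [xy xM]; apply: le_trans (ltW xM).
  apply: le_trans (metric_triangle _ x _) _; rewrite lerD2l.
  by move: xy; rewrite ballEmdist /= => /ltW.
have bnd x : mdist x0 x <= M + 1 by apply: MP; rewrite ?ltrDl.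
exists ((M + 1) + (M + 1)) => x y.
apply: le_trans (metric_triangle _ x0 _) _.
by rewrite lerD ?bnd// metric_sym bnd.
Qed.

Lemma le_unif_dist f g x : mdist (f x) (g x) <= unif_dist f g.
Proof.
have [M MP] := compact_mdist_bounded.
apply: ub_le_sup; last by exists x.
by exists M => _ [y _ <-]; exact: MP.
Qed.

Lemma unif_dist_le f g (M : R) :
  0 <= M -> (forall x, mdist (f x) (g x) <= M) -> unif_dist f g <= M.
Proof.
move=> M0 fgM; have [[x0]|noX] := pselect (inhabited X).
  apply: ge_sup; first by exists (mdist (f x0) (g x0)); exists x0.
  by move=> _ [x _ <-].
rewrite /unif_dist (_ : [set _ | _ in _] = set0) ?sup0//.
by apply/seteqP; split => // z [x _ _]; case: noX; exists.
Qed.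

Let unif_dist_ge0 f g : 0 <= unif_dist f g.
Proof.
have [[x0]|noX] := pselect (inhabited X).
  by apply: le_trans (le_unif_dist f g x0); exact: mdist_ge0.
rewrite /unif_dist (_ : [set _ | _ in _] = set0) ?sup0//.
by apply/seteqP; split => // z [x _ _]; case: noX; exists.
Qed.

Let unif_distxx f : unif_dist f f = 0.
Proof.
apply/eqP; rewrite eq_le unif_dist_ge0 andbT.
by apply: unif_dist_le => // x; rewrite mdistxx.
Qed.

Let unif_dist_positivity f g : unif_dist f g = 0 -> f = g.
Proof.
move=> fg0; apply/continuousEP => x; apply: mdist_positivity.
by apply/eqP; rewrite eq_le mdist_ge0 andbT -fg0 le_unif_dist.
Qed.

Let unif_dist_sym f g : unif_dist f g = unif_dist g f.
Proof.
rewrite /unif_dist; congr sup; apply/seteqP.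
by split => _ [x _ <-]; exists x => //; rewrite metric_sym.
Qed.

Let unif_dist_triangle g f h :
  unif_dist f h <= unif_dist f g + unif_dist g h.
Proof.
apply: unif_dist_le => [|x]; first exact: addr_ge0.
apply: le_trans (metric_triangle _ (g x) _) _.
by rewrite lerD// le_unif_dist.
Qed.

HB.instance Definition _ := Choice.copy (C0 cX) (continuousType X X).

HB.instance Definition _ := isMetric.Build R (C0 cX)
  unif_distxx unif_dist_positivity unif_dist_sym unif_dist_triangle.

Lemma mdist_C0 f g : mdist f g = unif_dist f g.
Proof. by []. Qed.

End uniform_metric.

Definition unit_interval (R : realType) : Type :=
  set_type (`[0, 1]%classic : set R).

Section unit_interval_metric.
Context {R : realType}.
Local Notation I := (unit_interval R).

HB.instance Definition _ := PseudoMetric.copy I (set_type (`[0, 1]%classic : set R)).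

Let dist (x y : I) : R := `|set_val x - set_val y|.

Let dist_ge0 x y : 0 <= dist x y.
Proof. exact: normr_ge0. Qed.

Let dist_positivity x y : dist x y = 0 -> x = y.
Proof. by move/normr0_eq0/subr0_eq/val_inj. Qed.

Let dist_ball (x : I) (d : R) : ball x d = [set y | dist x y < d].
Proof. by []. Qed.

HB.instance Definition _ :=
  PseudoMetric_isMetric.Build R I dist_ge0 dist_positivity dist_ball.

Lemma mdist_unit_interval (x y : I) : mdist x y = `|set_val x - set_val y|.
Proof. by []. Qed.

End unit_interval_metric.

Lemma unit_interval_compact (R : realType) : compact [set: unit_interval R].
Proof.
move=> F PF _.
have [|x [x01 clx]] := @segment_compact R 0 1 (set_val @ F) _.
  by apply: (@filterS _ F _ setT) filterT => -[x x01] _; exact: set_mem x01.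
exists (exist _ x (mem_set x01)); split => // A B FA.
rewrite -nbhs_ballE => -[e /= e0 eB].
have FA' : (set_val @ F) (set_val @` A).
  by apply: (@filterS _ F _ A) FA => y Ay; exists y.
have [_ [[y Ay <-]] xy] := clx _ _ FA' (nbhsx_ballx x e e0).
by exists y; split => //; apply: eB.
Qed.

(* Main.v *)
Require Import Defs.
From HB Require Import structures.
From mathcomp Require Import all_boot all_order all_algebra finmap.
From mathcomp Require Import all_classical all_reals all_analysis.
From mathcomp Require Import ring lra zify.

(** Every map has, uniformly close to it, maps with metric mean dimension [<= 0]
    and maps with both metric mean dimensions [>= 1/4], so neither dimension can
    be continuous.

    Small dimension: an [L]-Lipschitz map satisfies
    [sep(n, psi, e) <= 2 L^n / e], so [sep(psi, e) <= ln L + 1] stays bounded as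
    [e -> 0]; the inf-convolutions of [phi] are Lipschitz and converge uniformly
    to [phi].

    Large dimension: let [p] be a fixed point of [phi], and add to [phi(x)] the
    oscillation [min(eta, |phi(x) - x| + 2|x - p|) cos(pi / |x - p|)].  At
    distance [u = 1/k] from [p] the new map goes beyond [x + 2u] or below
    [x - 2u] according to the parity of [k].  Hence the points with [u] in
    [[1/(4m), 1/(2m)]] (on one side of [p]) form an arc covered by the image of
    each of the [m] subarcs [[1/(k+1), 1/k]] with [k = 2m + 2i], and these
    subarcs are more than [1/(4m)^2] apart.  Such a horseshoe gives
    [sep(psi, e) >= ln m] for [e <= 1/(4m)^2], that is, about
    [|ln e| / 2]. *)

Set Implicit Arguments.
Unset Strict Implicit.
Unset Printing Implicit Defensive.

Import Order.TTheory GRing.Theory Num.Theory.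
Import numFieldNormedType.Exports.

Local Open Scope classical_set_scope.
Local Open Scope ring_scope.

(** * Bounds on limits superior and inferior from eventual bounds *)

Section limf_bounds.
Context {T : choiceType} {X : filteredType T} {R : realType}.
Implicit Types (f : X -> \bar R) (c : \bar R).

Lemma limf_esup_le_near f (F : set_system X) c :
  (\forall x \near F, f x <= c)%E -> (limf_esup f F <= c)%E.
Proof.
move=> fc; apply: ge_ereal_inf; exists (ereal_sup (f @` [set x | (f x <= c)%E])).
  by exists [set x | (f x <= c)%E].
by apply: ge_ereal_sup => _ [x /= xc <-].
Qed.

(** Properness makes every [V] in the filter meet the set where the bound holds, so each supremum
    over [V] is at least [c]. *)
Lemma limf_esup_ge_near f (F : set_system X) {FF : ProperFilter F} c :
  (\forall x \near F, c <= f x)%E -> (c <= limf_esup f F)%E.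
Proof.
move=> fc; apply: le_ereal_inf_tmp => _ [V FV <-].
have [x [Vx cx]] := filter_ex (filterI FV fc).
by apply: le_ereal_sup_tmp; exists (f x) => //; exists x.
Qed.

Lemma limf_einf_le_near f (F : set_system X) {FF : ProperFilter F} c :
  (\forall x \near F, f x <= c)%E -> (limf_einf f F <= c)%E.
Proof.
move=> fc; rewrite /limf_einf leeNl; apply: limf_esup_ge_near.
by apply: filterS fc => x; rewrite leeN2.
Qed.

Lemma limf_einf_ge_near f (F : set_system X) {FF : Filter F} c :
  (\forall x \near F, c <= f x)%E -> (c <= limf_einf f F)%E.
Proof.
move=> fc; rewrite /limf_einf leeNr; apply: limf_esup_le_near.
by apply: filterS fc => x; rewrite leeN2.
Qed.

End limf_bounds.

(** * Separated sets and the entropy of horseshoes *)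

Section separated_sets.
Context {R : realType} {X : metricType R}.
Implicit Types (phi : X -> X) (n : nat) (e : R).

Lemma sep_card_ge1 (x : X) n phi e : (1 <= sep_card n phi e)%E.
Proof.
apply: le_ereal_sup_tmp; exists 1%E => //; exists [fset x]%fset.
  by move=> y z; rewrite !inE => /eqP -> /eqP ->.
by rewrite cardfs1.
Qed.

Section horseshoe.
Context (phi : X -> X) (J : set X) (m : nat) (K : 'I_m -> set X) (e : R).
Hypotheses (e0 : 0 <= e) (J0 : J !=set0) (KJ : forall i, K i `<=` J).
Hypothesis JK : forall i, J `<=` phi @` K i.
Hypothesis Ksep : forall i j x y, i != j -> K i x -> K j y -> e < mdist x y.

(** The orbit is built backwards: a point of [J] following the shifted word has a preimage in
    [K (w 0)]. Membership in [J] is carried along to feed the next pull-back. *)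
Lemma horseshoe_itinerary n (w : nat -> 'I_m) :
  exists x, J x /\ forall j, (j < n)%N -> K (w j) (iter j phi x).
Proof.
elim: n w => [|n IH] w; first by case: J0 => x Jx; exists x.
have [y [Jy yK]] := IH (w \o S).
have [x Kx xy] := JK (w 0) Jy.
exists x; split; first exact: KJ Kx.
by case=> [//|j] jn; rewrite iterSr xy; exact: (yK j).
Qed.

(** Each of the [m ^ n] words of length [n] is followed by some point. Two words differ at some
    letter [j], which puts the [j]-th iterates into different sets [K], more than [e] apart. *)
Lemma horseshoe_sep_card n : (0 < m)%N -> ((m%:R ^+ n)%:E <= sep_card n phi e)%E.
Proof.
move=> m0.
have /choice[pt ptP] (w : {ffun 'I_n -> 'I_m}) : exists x : X,
    forall j : 'I_n, K (w j) (iter j phi x).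
  have [x [_ xK]] :=
    (* The finite word is continued by an arbitrary letter beyond position [n]. *)
    horseshoe_itinerary n (fun j => if insub j is Some i then w i else Ordinal m0).
  exists x => j; have := xK j (ltn_ord j).
  by rewrite (valK j).
have ptsep w w' : w != w' -> e < bowen_dist phi n (pt w) (pt w').
  move=> /eqP/ffunP/existsNP[j /eqP wj].
  apply: lt_le_trans (le_bigmax _ _ j).
  exact: Ksep wj (ptP w j) (ptP w' j).
(* Different words with the same point would give [e < 0], since a point is at Bowen distance [0]
   from itself. *)
have ptinj : injective pt.
  move=> w w' ww'; apply/eqP/negP => /negP /ptsep.
  rewrite ww' /bowen_dist big1_idem ?ltNge ?e0 //=; [exact: maxxx|move=> i _; exact: mdistxx].
apply: le_ereal_sup_tmp; exists (m ^ n)%:R%:E; last by rewrite natrX.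
exists [fset pt w | w in {ffun 'I_n -> 'I_m}]%fset.
  move=> _ _ /imfsetP[w _ ->] /imfsetP[w' _ ->] ww'.
  by apply: ptsep; apply/eqP => ww; apply: ww'; rewrite ww.
rewrite card_imfset//=.
by rewrite -cardE card_ffun !card_ord.
Qed.

Lemma horseshoe_sep : (0 < m)%N -> ((ln m%:R)%:E <= sep phi e)%E.
Proof.
move=> m0; apply: limf_esup_ge_near.
exists 1%N => // n /= n1.
have mR : 0 < m%:R :> R by rewrite ltr0n.
have nR : 0 < n%:R :> R by rewrite ltr0n.
rewrite -[leLHS](_ : ((n%:R^-1)%:E * lne (m%:R ^+ n)%:E)%E = _); last first.
  rewrite lne_EFin ?exprn_gt0// lnXn// -EFinM -(mulr_natl (ln m%:R)) mulrA mulVf ?mul1r//.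
  by rewrite gt_eqF.
apply: lee_wpmul2l; first by rewrite lee_fin invr_ge0 ltW.
have mn : (0 <= (m%:R ^+ n)%:E :> \bar R)%E by rewrite lee_fin exprn_ge0// ltW.
rewrite lee_lne ?horseshoe_sep_card// in_itv/= leey andbT//.
exact: le_trans mn (horseshoe_sep_card _ _).
Qed.

End horseshoe.
End separated_sets.

(** * Self-maps of the interval from real functions *)

Section retraction.
Context {R : realType}.
Local Notation I := (unit_interval R).

Lemma clamp_subproof (x : R) : Num.max 0 (Num.min 1 x) \in (`[0, 1]%classic : set R).
Proof. by rewrite inE/= in_itv/= le_max lexx/= ge_max ler01 ge_min lexx. Qed.

(** The retraction of the line onto the interval: it turns any real formula into a self-map, and
    being 1-Lipschitz it increases neither distances nor Lipschitz constants. *)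
Definition clamp (x : R) : I :=
  exist _ (Num.max 0 (Num.min 1 x)) (clamp_subproof x).

Lemma val_clamp (x : R) : set_val (clamp x) = Num.max 0 (Num.min 1 x).
Proof. by []. Qed.

Lemma unit_interval_ge0 (x : I) : 0 <= set_val x.
Proof. by have := set_valP x; rewrite /= in_itv/= => /andP[]. Qed.

Lemma unit_interval_le1 (x : I) : set_val x <= 1.
Proof. by have := set_valP x; rewrite /= in_itv/= => /andP[]. Qed.

Lemma clampK (x : R) : 0 <= x <= 1 -> set_val (clamp x) = x.
Proof. by move=> /andP[x0 x1]; rewrite val_clamp (min_idPr x1) (max_idPr x0). Qed.

Lemma valK_clamp (x : I) : clamp (set_val x) = x.
Proof.
by apply: val_inj; apply: clampK; rewrite unit_interval_ge0 unit_interval_le1.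
Qed.

Lemma mdist_clamp (x y : R) : mdist (clamp x) (clamp y) <= `|x - y|.
Proof.
wlog xy : x y / x <= y => [hw|].
  have [/hw//|/ltW/hw] := leP x y.
  by rewrite metric_sym distrC.
rewrite mdist_unit_interval !val_clamp distrC (distrC x y) !ger0_norm ?subr_ge0//.
  rewrite lerBlDr ge_max; apply/andP; split.
    by rewrite addr_ge0 ?subr_ge0// le_max lexx.
  apply: (@le_trans _ _ (y - x + Num.min 1 x)); last by rewrite lerD2l le_max lexx orbT.
  rewrite addrC -lerBlDr le_min.
  have y1 : Num.min 1 y <= 1 by rewrite ge_min lexx.
  have yy : Num.min 1 y <= y by rewrite ge_min lexx orbT.
  by apply/andP; split; lra.
by rewrite le_max2// le_min2.
Qed.

Lemma continuous_clamp : continuous clamp.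
Proof.
move=> x; apply/metricType_numDomainType.cvgrPdist_lt => e e0.
apply/nbhs_ballP; exists e => //= y xy.
exact: le_lt_trans (mdist_clamp _ _) xy.
Qed.

Lemma continuous_set_val : continuous (set_val : I -> R).
Proof.
exact: initial_continuous.
Qed.

Lemma continuous_clamp_comp (F : R -> R) :
  continuous F -> continuous (clamp \o F \o set_val : I -> I).
Proof.
move=> cF x; apply: continuous_comp; first exact: continuous_set_val.
by apply: continuous_comp; [exact: cF|exact: continuous_clamp].
Qed.

Definition clamped (F : R -> R) (cF : continuous F) :
    C0 (@unit_interval_compact R) :=
  HB.pack (clamp \o F \o set_val : I -> I)
    (isContinuous.Build I I _ (continuous_clamp_comp cF)).

Lemma clampedE F (cF : continuous F) (x : I) : 
  clamped cF x = clamp (F (set_val x)).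
Proof. by []. Qed.

Lemma mdist_clamped (phi : C0 (@unit_interval_compact R)) F (cF : continuous F) e :
    0 <= e -> (forall x : I, `|set_val (phi x) - F (set_val x)| <= e) ->
  mdist phi (clamped cF) <= e.
Proof.
move=> e0 He; apply: unif_dist_le => // x; rewrite clampedE -[phi x]valK_clamp.
exact: le_trans (mdist_clamp _ _) (He x).
Qed.

End retraction.

(** * Lipschitz maps have metric mean dimension at most zero *)

Section lipschitz_maps.
Context {R : realType}.
Local Notation I := (unit_interval R).

Lemma bowen_dist_lipschitz (X : metricType R) (phi : X -> X) (L : R) n x y :
    1 <= L -> (forall x y, mdist (phi x) (phi y) <= L * mdist x y) ->
  bowen_dist phi n x y <= L ^+ n * mdist x y.
Proof.
move=> L1 phiL; have L0 : 0 <= L by exact: le_trans L1.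
apply: bigmax_le => [|j _]; first by rewrite mulr_ge0 ?exprn_ge0 ?mdist_ge0.
have iterL k : mdist (iter k phi x) (iter k phi y) <= L ^+ k * mdist x y.
  elim: k => [|k IH]; first by rewrite expr0 mul1r.
  by rewrite !iterS (le_trans (phiL _ _))// exprS -mulrA ler_wpM2l.
apply: le_trans (iterL j) _; rewrite ler_wpM2r ?mdist_ge0//.
by rewrite ler_weXn2l// ltnW.
Qed.

(** Each cell [[k d, (k + 1) d)] holds at most one point of [A], and at most [1 / d + 1] cells meet
    the interval; [d <= 1] absorbs the extra cell into [2 / d]. *)
Lemma unit_interval_card_separated (A : {fset I}) (d : R) : 0 < d -> d <= 1 ->
    (forall x y, x \in A -> y \in A -> x <> y -> d < mdist x y) ->
  #|` A|%:R <= 2 / d.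
Proof.
move=> d0 d1 Ad.
pose cell (x : I) := Num.trunc (set_val x / d).
have cellP x : (cell x)%:R * d <= set_val x < (cell x)%:R * d + d.
  have := @truncn_itv _ (set_val x / d).
  rewrite divr_ge0 ?unit_interval_ge0 ?(ltW d0)//.
  by rewrite ler_pdivlMr// ltr_pdivrMr// -natr1 mulrDl mul1r => /(_ isT).
have cell_inj : {in A &, injective cell}.
  move=> x y xA yA cxy; apply: contrapT => /(Ad _ _ xA yA).
  move: (cellP x) (cellP y); rewrite cxy mdist_unit_interval.
  move=> /andP[x1 x2] /andP[y1 y2]; apply/negP; rewrite -leNgt.
  by rewrite ler_norml; apply/andP; split; lra.
have sizeA : (#|` A| <= (Num.trunc d^-1).+1)%N.
  rewrite -(size_map cell) -(size_iota 0 (Num.trunc d^-1).+1).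
  apply: uniq_leq_size => [|_ /mapP[x _ ->]].
    by rewrite map_inj_in_uniq ?fset_uniq.
  rewrite mem_iota/= add0n ltnS le_truncn// -[leRHS]mul1r ler_wpM2r//.
    by rewrite invr_ge0 ltW.
  exact: unit_interval_le1.
apply: (@le_trans _ _ (Num.trunc d^-1).+1%:R); first by rewrite ler_nat.
have d1' : 1 <= d^-1 by rewrite invf_ge1.
have : (Num.trunc d^-1)%:R <= d^-1 by rewrite truncn_le invr_ge0 ltW.
by rewrite -natr1; lra.
Qed.

Context (phi : I -> I) (L : R).
Hypotheses (L1 : 1 <= L)
  (phiL : forall x y, mdist (phi x) (phi y) <= L * mdist x y).

Let L0 : 0 < L. Proof. exact: lt_le_trans L1. Qed.

(** The map expands distances by at most [L ^ n] within [n] steps, so a Bowen separated set at scale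
    [e] is separated at scale [e / L ^ n] in the original metric. *)
Lemma lipschitz_sep_card n (e : R) : 0 < e -> e <= 1 ->
  (sep_card n phi e <= (2 / e * L ^+ n)%:E)%E.
Proof.
move=> e0 e1; have Ln0 : 0 < L ^+ n by rewrite exprn_gt0.
apply: ge_ereal_sup => _ [A Asep <-]; rewrite lee_fin.
have -> : 2 / e * L ^+ n = 2 / (e / L ^+ n).
  by rewrite invf_div mulrA mulrAC.
apply: unit_interval_card_separated => [||x y xA yA xy].
- by rewrite divr_gt0.
- by rewrite ler_pdivrMr// mul1r (le_trans e1)// exprn_ege1.
- rewrite ltr_pdivrMr// mulrC (lt_le_trans (Asep _ _ xA yA xy))//.
  exact: bowen_dist_lipschitz.
Qed.

Lemma lipschitz_sep (e : R) : 0 < e -> e <= 1 -> (sep phi e <= (ln L + 1)%:E)%E.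
Proof.
move=> e0 e1; apply: limf_esup_le_near.
have e2 : 0 < 2 / e by rewrite divr_gt0.
(* From this [n] on, [ln (2 / e) / n] is at most [1], the summand added to [ln L]. *)
exists (Num.trunc (ln (2 / e))).+1 => // n /= n1.
have n0 : 0 < n%:R :> R by rewrite ltr0n (leq_trans _ n1).
have Ln0 : 0 < L ^+ n by rewrite exprn_gt0.
have lne_le : (lne (sep_card n phi e) <= (ln (2 / e) + ln L *+ n)%:E)%E.
  rewrite -lnXn// -lnM ?posrE// -lne_EFin ?mulr_gt0 ?invr_gt0//.
  have s0 : (0 <= sep_card n phi e)%E by apply: le_trans (sep_card_ge1 (clamp 0) _ _ _).
  rewrite lee_lne ?lipschitz_sep_card// in_itv/= leey andbT//.
  exact: le_trans s0 (lipschitz_sep_card _ _ _).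
apply: (@le_trans _ _ ((n%:R^-1)%:E * (ln (2 / e) + ln L *+ n)%:E)%E).
  by apply: lee_wpmul2l => //; rewrite lee_fin invr_ge0 ltW.
rewrite -EFinM lee_fin mulrC ler_pdivrMr// mulr_natr mulrnDl addrC lerD2l.
apply: le_trans (ltW (truncnS_gt _)) _.
by rewrite ler_nat.
Qed.

(** The bound [ln L + 1] on [sep] does not depend on [e], while [|ln e|] tends to infinity. *)
Lemma lipschitz_mdim : (upper_mdim phi <= 0 /\ lower_mdim phi <= 0)%E.
Proof.
have small (c : R) : 0 < c ->
    (\forall e \near 0^'+, sep phi e * (`|ln e|^-1)%:E <= c%:E)%E.
  move=> c0; near=> e.
  have e0 : 0 < e by near: e; exact: nbhs_right_gt.
  have e1 : e < 1 by near: e; apply: nbhs_right_lt.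
  have lnL : 0 <= ln L by exact: ln_ge0.
  have ln0 : (ln L + 1) / c < `|ln e|.
    rewrite ltr0_norm ?ln_lt0 ?e0// ltrNr -ltr_expR lnK//.
    by near: e; apply: nbhs_right_lt; exact: expR_gt0.
  have ln1 : 0 < `|ln e| by apply: le_lt_trans ln0; rewrite divr_ge0 ?addr_ge0// ltW.
  apply: (@le_trans _ _ ((ln L + 1)%:E * (`|ln e|^-1)%:E)%E).
    apply: lee_wpmul2r; first by rewrite lee_fin invr_ge0.
    exact: lipschitz_sep (ltW e1).
  rewrite -EFinM lee_fin ler_pdivrMr//.
  by move: ln0; rewrite ltr_pdivrMr// mulrC => /ltW.
split; apply/lee_addgt0Pr => c c0; rewrite add0e.
  by apply: limf_esup_le_near; exact: small.
by apply: limf_einf_le_near; exact: small.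
Unshelve. all: by end_near. Qed.

End lipschitz_maps.

(** * Uniform approximation by Lipschitz maps *)

Section lipschitz_approximation.
Context {R : realType}.
Local Notation I := (unit_interval R).
Local Notation C0I := (C0 (@unit_interval_compact R)).

Lemma unit_interval_mdist_le1 (x y : I) : mdist x y <= 1.
Proof.
rewrite mdist_unit_interval ler_norml.
have := unit_interval_ge0 x; have := unit_interval_le1 x.
have := unit_interval_ge0 y; have := unit_interval_le1 y.
by move=> *; apply/andP; split; lra.
Qed.

(** For nearby points continuity gives the term [e]; for distant ones a large [L] makes
    [L * mdist x y] exceed the diameter [1]. Compactness gives one [L] for all points. *)
Lemma C0_almost_lipschitz (phi : C0I) (e : R) : 0 < e ->
  exists2 L, 1 <= L & forall x y, mdist (phi x) (phi y) <= e + L * mdist x y.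
Proof.
move=> e0; have e20 : 0 < e / 2 by rewrite divr_gt0.
have /compact_near_coveringP cov := @unit_interval_compact R.
have [x _|M [Mreal MP]] := cov R +oo
    (fun L x => forall y, mdist (phi x) (phi y) <= e + L * mdist x y) _.
  have /metricType_numDomainType.cvgrPdist_lt /(_ _ e20) := @cts_fun _ _ phi x.
  rewrite -metricType_numDomainType.nbhs_nbhs_mdist => -[/= d d0 dP].
  (* Slope [2 / d] reaches the diameter [1] at distance [d / 2]; points closer than that to [z]
     remain within [d] of [x]. *)
  exists (ball x (d / 2), [set L | 2 / d < L]).
    split => /=; first by apply: nbhsx_ballx; rewrite divr_gt0.
    by exists (2 / d); split => //; exact: num_real.
  move=> [z L] /= [xz dL] y; move: xz; rewrite ballEmdist /= => xz.
  have phixz : mdist (phi x) (phi z) < e / 2 by apply: dP => /=; lra.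
  have L0 : 0 < L by apply: lt_trans dL; rewrite divr_gt0.
  have Lzy : 0 <= L * mdist z y by rewrite mulr_ge0 ?mdist_ge0// ltW.
  have [zy|zy] := ltP (mdist z y) (d / 2).
    have phixy : mdist (phi x) (phi y) < e / 2.
      by apply: dP => /=; have := metric_triangle x z y; lra.
    have := metric_triangle (phi z) (phi x) (phi y).
    by rewrite (metric_sym (phi z) (phi x)); lra.
  have : 1 <= L * mdist z y.
    apply: (@le_trans _ _ (2 / d * (d / 2))).
      by rewrite mulrA mulfVK ?divff// gt_eqF.
    by apply: ler_pM => //; rewrite ?divr_ge0 ?ltW.
  by have := unit_interval_mdist_le1 (phi z) (phi y); lra.
exists (Num.max 1 (M + 1)); first by rewrite le_max lexx.
move=> x y; apply: MP => //.
by rewrite lt_max ltrDl ltr01 orbT.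
Qed.

Section inf_convolution.
Context (phi : C0I) (L : R).
Hypothesis L0 : 0 <= L.

(** For [0 <= L] this is the largest [L]-Lipschitz function lying below [phi] on the interval, also
    known as the Pasch-Hausdorff envelope. *)
Definition inf_conv (x : R) : R :=
  inf [set set_val (phi y) + L * `|x - set_val y| | y in [set: I]].

Let inf_conv_le x y : inf_conv x <= set_val (phi y) + L * `|x - set_val y|.
Proof.
apply: ge_inf; last by exists y.
exists 0 => _ [z _ <-]; by rewrite addr_ge0 ?mulr_ge0 ?unit_interval_ge0.
Qed.

Let le_inf_conv x c :
  (forall y, c <= set_val (phi y) + L * `|x - set_val y|) -> c <= inf_conv x.
Proof.
move=> cP; apply: lb_le_inf => [|_ [y _ <-]//].
by exists (set_val (phi (clamp 0)) + L * `|x - set_val (clamp 0)|); exists (clamp 0).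
Qed.

Lemma inf_conv_lipschitz x y : `|inf_conv x - inf_conv y| <= L * `|x - y|.
Proof.
wlog xy : x y / inf_conv y <= inf_conv x => [hw|].
  have [/hw|/ltW/hw//] := leP (inf_conv x) (inf_conv y).
  by rewrite distrC (distrC y).
rewrite ger0_norm ?subr_ge0// lerBlDr addrC -lerBlDr; apply: le_inf_conv => z.
rewrite lerBlDr -addrA -mulrDr; apply: le_trans (inf_conv_le x z) _.
by rewrite lerD2l ler_wpM2l// [leRHS]addrC ler_distD.
Qed.

Lemma continuous_inf_conv : continuous inf_conv.
Proof.
move=> x; apply/cvgrPdist_lt => e e0.
(* Dividing by [L + 1] covers the case [L = 0]. *)
apply/nbhs_ballP; exists (e / (L + 1)) => [|y] /=.
  by rewrite divr_gt0// ltr_wpDl.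
rewrite /ball/= ltr_pdivlMr ?ltr_wpDl// => xy.
apply: le_lt_trans (inf_conv_lipschitz x y) (le_lt_trans _ xy).
by rewrite mulrC ler_wpM2l// lerDl.
Qed.

(** The infimum is at most its term at [y = x], which is [phi x]; the almost Lipschitz bound keeps
    every other term above [phi x - e]. *)
Lemma inf_conv_dist (e : R) :
    (forall x y, mdist (phi x) (phi y) <= e + L * mdist x y) ->
  forall x : I, `|set_val (phi x) - inf_conv (set_val x)| <= e.
Proof.
move=> eL x; have xx : inf_conv (set_val x) <= set_val (phi x).
  by apply: le_trans (inf_conv_le _ x) _; rewrite subrr normr0 mulr0 addr0.
rewrite ger0_norm ?subr_ge0// lerBlDr addrC -lerBlDr; apply: le_inf_conv => y.
have := eL x y; rewrite !mdist_unit_interval.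
by have := ler_norm (set_val (phi x) - set_val (phi y)); lra.
Qed.

End inf_convolution.

Lemma mdim_le0_dense (phi : C0I) (e : R) : 0 < e ->
  exists psi : C0I, [/\ mdist phi psi <= e,
    (lower_mdim psi <= 0)%E & (upper_mdim psi <= 0)%E].
Proof.
move=> e0; have [L L1 phiL] := C0_almost_lipschitz phi e0.
have L0 : 0 <= L by exact: le_trans L1.
exists (clamped (continuous_inf_conv (phi := phi) L0)).
have [|ups lows] := @lipschitz_mdim _ (clamped (continuous_inf_conv (phi := phi) L0)) L L1.
  move=> x y; rewrite !clampedE; apply: le_trans (mdist_clamp _ _) _.
  exact: inf_conv_lipschitz.
split => //; apply: mdist_clamped => [|x]; first exact: ltW.
exact: inf_conv_dist.
Qed.

End lipschitz_approximation.

(** * Oscillating perturbation near a fixed point *)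

Section oscillating_perturbation.
Context {R : realType}.
Local Notation I := (unit_interval R).
Local Notation C0I := (C0 (@unit_interval_compact R)).

Lemma cos_natpi (k : nat) : cos (pi * k%:R) = (-1) ^+ k :> R.
Proof.
elim: k => [|k IH]; first by rewrite mulr0 cos0.
by rewrite -natr1 mulrDr mulr1 cosDpi IH exprS mulN1r.
Qed.

(** Constant continuation outside [[0, 1]], so that continuity and the intermediate value theorem
    can be used on the whole line. *)
Definition extend (phi : C0I) (x : R) : R := set_val (phi (clamp x)).

Lemma extend_val (phi : C0I) (x : I) : extend phi (set_val x) = set_val (phi x).
Proof. by rewrite /extend valK_clamp. Qed.

Lemma continuous_extend (phi : C0I) : continuous (extend phi).
Proof.
move=> x; apply: (@continuous_comp _ _ _ (phi \o clamp) set_val).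
  by apply: continuous_comp; [exact: continuous_clamp|exact: cts_fun].
exact: continuous_set_val.
Qed.

Lemma extend_fixpoint (phi : C0I) : exists2 p, 0 <= p <= 1 & extend phi p = p.
Proof.
have [||p] := @IVT R (fun x => extend phi x - x) 0 1 0 ler01.
- apply: continuous_subspaceT => x.
  by apply: continuousB; [exact: continuous_extend|exact: cvg_id].
- rewrite ge_min le_max subr0 /extend subr_ge0 subr_le0.
  by rewrite unit_interval_ge0 unit_interval_le1 orbT.
by rewrite in_itv/= => p01 /eqP; rewrite subr_eq0 => /eqP; exists p.
Qed.

Section construction.
Context (phi : C0I) (eta p : R).
Hypotheses (eta0 : 0 < eta) (phip : extend phi p = p).
Local Notation f := (extend phi).

Let cf : continuous f := @continuous_extend phi.

(** The term [|f x - x|] brings the graph back to the diagonal, and [2 * |x - p|] is the overshoot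
    past it; the cap [eta] keeps the perturbation uniformly small. *)
Definition amplitude (x : R) : R := Num.min eta (`|f x - x| + 2 * `|x - p|).

(* At [x = p] the cosine is evaluated at the junk value [pi / 0 = 0], but the
   amplitude vanishes there. *)
Definition oscillate (x : R) : R := f x + amplitude x * cos (pi / `|x - p|).

Lemma continuous_swing : continuous (fun x => `|f x - x| + 2 * `|x - p|).
Proof.
move=> x; apply: cvgD.
  by apply: cvg_norm; apply: cvgB; [exact: cf|exact: cvg_id].
by apply: cvgMr; apply: cvg_norm; apply: cvgB; [exact: cvg_id|exact: cvg_cst].
Qed.

Lemma continuous_amplitude : continuous amplitude.
Proof.
by apply: (@min_fun_continuous _ R R (fun=> eta) _ _ continuous_swing) => x; exact: cvg_cst.
Qed.

Lemma amplitude_ge0 x : 0 <= amplitude x.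
Proof. by rewrite le_min (ltW eta0) addr_ge0// mulr_ge0. Qed.

Lemma oscillation_le x : `|amplitude x * cos (pi / `|x - p|)| <= amplitude x.
Proof.
rewrite normrM (ger0_norm (amplitude_ge0 x)) ler_piMr ?amplitude_ge0//.
by rewrite ler_norml cos_le1 cos_geN1.
Qed.

(** Only [p] is delicate: the cosine has no limit there, but the amplitude tends to [0] because [p]
    is fixed, and the product is squeezed. *)
Lemma continuous_oscillate : continuous oscillate.
Proof.
move=> x; apply: cvgD; first exact: cf.
have [->|xp] := eqVneq x p.
  have Ap : amplitude p = 0.
    by rewrite /amplitude phip !subrr normr0 mulr0 addr0 (min_idPr (ltW eta0)).
  rewrite Ap mul0r; apply: norm_cvg0.
  have Acvg : amplitude y @[y --> p] --> 0 by rewrite -Ap; exact: continuous_amplitude.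
  apply: (squeeze_cvgr _ (cvg_cst 0) Acvg).
  by near=> y; rewrite normr_ge0 oscillation_le.
apply: cvgM; first exact: continuous_amplitude.
apply: (@continuous_comp _ _ _ (fun y => pi / `|y - p|) cos); last exact: continuous_cos.
apply: cvgM; first exact: cvg_cst.
apply: cvgV; first by rewrite normr_eq0 subr_eq0.
by apply: cvg_norm; apply: cvgB; [exact: cvg_id|exact: cvg_cst].
Unshelve. all: by end_near. Qed.

Definition perturb : C0I := clamped continuous_oscillate.

Lemma mdist_perturb : mdist phi perturb <= eta.
Proof.
apply: mdist_clamped => [|x]; first exact: ltW.
rewrite -extend_val /oscillate opprD addrA subrr add0r normrN.
by apply: le_trans (oscillation_le _) _; rewrite ge_min lexx.
Qed.

(** The uncapped amplitude is continuous and vanishes at [p], so the cap [eta] is inactive near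
    [p]. *)
Lemma amplitude_near : exists2 d, 0 < d &
  forall x, `|x - p| < d -> amplitude x = `|f x - x| + 2 * `|x - p|.
Proof.
have /cvgrPdist_lt/(_ _ eta0) := @continuous_swing p.
rewrite phip !subrr normr0 mulr0 addr0 => /nbhs_ballP[d /= d0 dP].
exists d => // x xd; apply: min_idPr; apply: ltW.
have := dP x; rewrite /ball/= distrC => /(_ xd); rewrite sub0r normrN.
exact/le_lt_trans/ler_norm.
Qed.

End construction.
End oscillating_perturbation.

(** * Horseshoes of the perturbed map *)

Section horseshoes.
Context {R : realType}.
Local Notation I := (unit_interval R).
Local Notation C0I := (C0 (@unit_interval_compact R)).
Context (phi : C0I) (eta p d s : R).
Hypotheses (eta0 : 0 < eta) (phip : extend phi p = p).
Hypothesis ampE : forall x, `|x - p| < d ->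
  amplitude phi eta p x = `|extend phi x - x| + 2 * `|x - p|.
(* The sign [s] selects a side of [p] on which there is room inside [0, 1]. *)
Hypothesis s1 : `|s| = 1.
Hypothesis side : forall u : R, 0 <= u <= 2^-1 -> 0 <= p + s * u <= 1.

Local Notation F := (oscillate phi eta p).
Local Notation psi := (perturb eta0 phip).

Let sideB u : `|p + s * u - p| = `|u|.
Proof. by rewrite addrAC subrr add0r normrM s1 mul1r. Qed.

(** At distance [1 / k] the cosine is [(-1) ^ k], and adding or subtracting [|f x - x|] moves [f x]
    to or past [x]. *)
Lemma oscillate_peak (k : nat) (u : R) : (0 < k)%N -> u = k%:R^-1 -> u < d ->
  if odd k then F (p + s * u) <= p + s * u - 2 * u
  else p + s * u + 2 * u <= F (p + s * u).
Proof.
move=> k0 uk ud; have u0 : 0 < u by rewrite uk invr_gt0 ltr0n.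
have nu : `|p + s * u - p| = u by rewrite sideB gtr0_norm.
have uV : u^-1 = k%:R by rewrite uk invrK.
rewrite /oscillate ampE nu// uV cos_natpi -signr_odd.
have := ler_norm (extend phi (p + s * u) - (p + s * u)).
have := ler_norm (- (extend phi (p + s * u) - (p + s * u))); rewrite normrN.
by case: (odd k); rewrite ?expr0 ?expr1; lra.
Qed.

(** Parametrising by the distance [u] to [p] treats both sides of [p] at once. *)
Let arc (a b : R) : set I := [set x | exists2 u, a <= u <= b & set_val x = p + s * u].

Context (m : nat).
Hypotheses (m0 : (0 < m)%N) (md : (m.*2)%:R^-1 < d).

Let J := arc (m.*2.*2)%:R^-1 (m.*2)%:R^-1.
(** Each arc runs from an odd peak to an even one; skipping every other interval between consecutive
    peaks leaves the gaps that separate the arcs. *)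
Let K (i : 'I_m) := arc (m + i).*2.+1%:R^-1 (m + i).*2%:R^-1.

Let inv_nat_le (a b : nat) : (0 < a)%N -> (a <= b)%N -> b%:R^-1 <= a%:R^-1 :> R.
Proof.
move=> a0 ab; rewrite lef_pV2 ?posrE ?ltr0n ?ler_nat//.
exact: leq_trans ab.
Qed.

Let le_half (u : R) : u <= (m.*2)%:R^-1 -> u <= 2^-1.
Proof.
move=> /le_trans; apply; apply: (@inv_nat_le 2) => //.
by rewrite -[2%N]/(1.*2) leq_double.
Qed.

Lemma arc_sub_base i : K i `<=` J.
Proof.
have im := ltn_ord i.
move=> x [u /andP[u1 u2] xu]; exists u => //; apply/andP; split.
  apply: le_trans u1; apply: inv_nat_le => //; lia.
apply: le_trans u2 _; apply: inv_nat_le; lia.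
Qed.

(** Points of [J] are at most twice as far from [p] as any point of [K i], so the overshoot [2 * u]
    at the two ends of [K i] passes all of [J] on opposite sides. The intermediate value theorem
    then yields a preimage. *)
Lemma base_sub_image i : J `<=` psi @` K i.
Proof.
move=> y [t /andP[t1 t2] yt]; have im := ltn_ord i.
pose k := (m + i).*2.
have k0 : (0 < k)%N by rewrite /k; lia.
have kk : k.+1%:R^-1 <= k%:R^-1 :> R by exact: inv_nat_le.
have km : k%:R^-1 <= (m.*2)%:R^-1 :> R by apply: inv_nat_le; rewrite /k; lia.
have mk : (m.*2.*2)%:R^-1 <= k.+1%:R^-1 :> R by apply: inv_nat_le; rewrite /k; lia.
have t0 : 0 < t by apply: lt_le_trans t1; rewrite invr_gt0 ltr0n; lia.
have t2' : t <= 2 * k.+1%:R^-1.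
  apply: le_trans t2 (le_trans _ (ler_wpM2l _ mk)) => //.
  by rewrite -(muln2 m.*2) natrM invfM mulrCA divff// mulr1.
have crossing u : 0 < u -> t <= 2 * u ->
    p + s * u - 2 * u <= p + s * t <= p + s * u + 2 * u.
  move=> u0 tu; rewrite -ler_distl opprD addrACA subrr add0r -mulrBr normrM s1 mul1r.
  by rewrite ler_norml; apply/andP; split; lra.
have odd_peak := @oscillate_peak k.+1 _ isT erefl (le_lt_trans (le_trans kk km) md).
have even_peak := @oscillate_peak k _ k0 erefl (le_lt_trans km md).
rewrite /= /k odd_double /= -/k in odd_peak even_peak.
have := crossing k.+1%:R^-1; rewrite invr_gt0 ltr0n => /(_ isT t2') /andP[l1 _].
have := crossing k%:R^-1; rewrite invr_gt0 ltr0n k0.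
move=> /(_ isT (le_trans t2' (ler_wpM2l _ kk))) /andP[//|_ l2].
have [||u] := @IVT R (fun u => F (p + s * u)) k.+1%:R^-1 k%:R^-1 (p + s * t) kk.
- apply: continuous_subspaceT => u.
  apply: (@continuous_comp _ _ _ (fun u => p + s * u) F).
    by apply: cvgD; [exact: cvg_cst|apply: cvgMr; exact: cvg_id].
  exact: continuous_oscillate.
- rewrite ge_min le_max; apply/andP; split; apply/orP; [left|right].
    exact: le_trans odd_peak l1.
  exact: le_trans l2 even_peak.
rewrite in_itv/= => /andP[u1 u2] Fu.
have u01 : 0 <= p + s * u <= 1.
  apply: side; rewrite (le_trans _ u1) ?invr_ge0//=.
  exact: le_half (le_trans u2 km).
exists (clamp (p + s * u)).
  by exists u; [rewrite u1 u2|rewrite clampK].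
(* The value reached is [set_val y], already in the interval, so clamping leaves it unchanged. *)
by rewrite -[LHS]/(clamp (F (set_val (clamp (p + s * u))))) clampK// Fu -yt valK_clamp.
Qed.

(** For [i < j] the skipped interval from [1 / (k + 1)] to [1 / k], with [k = 2 (m + i) + 1], lies
    between the arcs. Its length is [1 / (k (k + 1))], and [k + 1 <= 4 m]. *)
Lemma arc_separated i j x y : i != j -> K i x -> K j y ->
  ((4 * m) ^ 2)%:R^-1 < mdist x y.
Proof.
wlog ij : i j x y / (i < j)%N => [hw|].
  move=> nij Kx Ky; case: (ltngtP i j) => ij.
  - exact: hw ij nij Kx Ky.
  - by rewrite metric_sym; apply: hw ij _ Ky Kx; rewrite eq_sym.
  - by rewrite (val_inj ij) eqxx in nij.
move=> _ [u /andP[u1 _] xu] [v /andP[_ v1] yv].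
rewrite mdist_unit_interval xu yv opprD addrACA subrr add0r -mulrBr normrM s1 mul1r.
apply: lt_le_trans (ler_norm _).
have jm := ltn_ord j.
pose k := (m + i).*2.+1.
have v2 : v <= k.+1%:R^-1 by apply: le_trans v1 _; apply: inv_nat_le; rewrite /k; lia.
have : ((4 * m) ^ 2)%:R^-1 < (k * k.+1)%:R^-1 :> R.
  rewrite ltf_pV2 ?posrE ?ltr0n ?ltr_nat; rewrite /k; nia.
have -> : (k * k.+1)%:R^-1 = k%:R^-1 - k.+1%:R^-1 :> R.
  rewrite natrM invfM -natr1; field.
  by rewrite natr1 !pnatr_eq0.
by move=> /lt_le_trans; apply; apply: lerB.
Qed.

Lemma perturb_sep (e : R) : 0 <= e -> e <= ((4 * m) ^ 2)%:R^-1 ->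
  ((ln m%:R)%:E <= sep psi e)%E.
Proof.
move=> e0 em; apply: (@horseshoe_sep _ _ psi J m K e) => //.
- exists (clamp (p + s * (m.*2)%:R^-1)); exists (m.*2)%:R^-1.
    by rewrite lexx andbT inv_nat_le//; lia.
  by rewrite clampK// side// invr_ge0 ler0n/= le_half.
- exact: arc_sub_base.
- exact: base_sub_image.
- by move=> i j x y ij Kx Ky; apply: le_lt_trans em (arc_separated ij Kx Ky).
Qed.

End horseshoes.

(** * From horseshoes at all small scales to dimension at least [1/4] *)

Section positive_mdim.
Context {R : realType}.
Local Notation C0I := (C0 (@unit_interval_compact R)).

Lemma mdim_ge4V (X : metricType R) (psi : X -> X) (M : nat) :
    (forall m e, (M <= m)%N -> 0 <= e -> e <= ((4 * m) ^ 2)%:R^-1 ->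
      ((ln m%:R)%:E <= sep psi e)%E) ->
  ((4^-1)%:E <= lower_mdim psi)%E /\ ((4^-1)%:E <= upper_mdim psi)%E.
Proof.
move=> Msep.
have large : (\forall e \near 0^'+, (4^-1)%:E <= sep psi e * (`|ln e|^-1)%:E)%E.
  (* The bound [8] is what later gives [4 (m + 1) <= m ^ 2]. *)
  pose N := maxn M 8; have N8 : (8 <= N)%N by rewrite leq_maxr.
  near=> e.
  have e0 : 0 < e by near: e; exact: nbhs_right_gt.
  have eN : e < ((4 * N) ^ 2)%:R^-1.
    by near: e; apply: nbhs_right_lt; rewrite invr_gt0 ltr0n; nia.
  (* This [m] is the largest integer with [e <= 1 / (4 m) ^ 2]. *)
  pose r := Num.sqrt e^-1; pose m := Num.trunc (r / 4).
  have ei0 : 0 < e^-1 by rewrite invr_gt0.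
  have r0 : 0 < r by rewrite sqrtr_gt0.
  have rE : r ^+ 2 = e^-1 by rewrite sqr_sqrtr// ltW.
  have r40 : 0 <= r / 4 by rewrite divr_ge0 ?ltW.
  have /andP[m1 m2] := truncn_itv r40; rewrite -/m in m1 m2.
  have Nm : (N <= m)%N.
    rewrite truncn_ge_nat// ler_pdivlMr// -natrM mulnC.
    rewrite -ler_sqr ?nnegrE ?ler0n ?(ltW r0)// rE -natrX.
    by rewrite -[leLHS]invrK lef_pV2 ?posrE ?invr_gt0 ?ltr0n// ?ltW//; nia.
  have mR : 8 <= m%:R :> R by rewrite ler_nat (leq_trans N8).
  have lnm : ((ln m%:R)%:E <= sep psi e)%E.
    apply: Msep (ltW e0) _; first by rewrite (leq_trans _ Nm)// leq_maxl.
    rewrite -[leLHS]invrK lef_pV2 ?posrE// ?ltr0n; last by nia.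
    rewrite -rE natrX ler_sqr ?nnegrE ?ler0n ?(ltW r0)//.
    by rewrite natrM; lra.
  (* Maximality of [m] gives [r < 4 (m + 1) <= m ^ 2], hence [1 / e <= m ^ 4]. Settling for [1/4]
     instead of [1/2] absorbs the constants. *)
  have lne : `|ln e| <= 4 * ln m%:R.
    have e1 : e < 1 by apply: lt_le_trans eN _; rewrite invf_le1 ?ltr0n ?ler1n; nia.
    rewrite ltr0_norm ?ln_lt0 ?e0// -lnV ?posrE// -rE.
    have -> : 4 * ln m%:R = ln (m%:R ^+ 4) :> R by rewrite lnXn ?mulr_natl//; lra.
    rewrite ler_ln ?posrE ?exprn_gt0//; last by lra.
    rewrite (exprM _ 2 2) ler_sqr ?nnegrE ?sqr_ge0 ?(ltW r0)//.
    have mm : 8 * m%:R <= m%:R * m%:R :> R by rewrite ler_wpM2r.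
    by move: m2; rewrite -[m.+1%:R]natr1 expr2; lra.
  have ln0 : 0 < `|ln e|.
    by rewrite normr_gt0 lt_eqF// ln_lt0// e0; apply: lt_le_trans eN _;
       rewrite invf_le1 ?ltr0n ?ler1n; nia.
  apply: (@le_trans _ _ ((ln m%:R)%:E * (`|ln e|^-1)%:E)%E).
    by rewrite -EFinM lee_fin ler_pdivlMr//; lra.
  by apply: lee_wpmul2r => //; rewrite lee_fin invr_ge0.
split.
  by apply: limf_einf_ge_near; exact: large.
by apply: limf_esup_ge_near; exact: large.
Unshelve. all: by end_near. Qed.

Lemma mdim_ge4V_dense (phi : C0I) (e : R) : 0 < e ->
  exists psi : C0I, [/\ mdist phi psi <= e,
    ((4^-1)%:E <= lower_mdim psi)%E & ((4^-1)%:E <= upper_mdim psi)%E].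
Proof.
move=> e0; have [p /andP[p0 p1] phip] := extend_fixpoint phi.
have [d d0 ampE] := amplitude_near e0 phip.
have [s s1 side] : exists2 s : R, `|s| = 1 &
    forall u : R, 0 <= u <= 2^-1 -> 0 <= p + s * u <= 1.
  have [p2|p2] := lerP p 2^-1.
    by exists 1; rewrite ?normr1// => u /andP[u0 u1]; apply/andP; split; lra.
  by exists (-1); rewrite ?normrN1// => u /andP[u0 u1]; apply/andP; split; lra.
exists (perturb e0 phip).
(* Beyond [1 / d], every [m] satisfies [1 / (2 m) < d], so its whole horseshoe lies where the
   amplitude is uncapped. *)
have [m c Mm c0 cm|lo up] := @mdim_ge4V _ (perturb e0 phip) (Num.trunc d^-1).+1.
  apply: (perturb_sep e0 phip ampE s1 side _ _ c0 cm).
    exact: leq_trans Mm.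
  rewrite -[ltRHS]invrK ltf_pV2 ?posrE ?invr_gt0 ?ltr0n//; last by lia.
  by apply: lt_le_trans (truncnS_gt _) _; rewrite ler_nat -addnn (leq_trans Mm)// leq_addr.
by split => //; exact: mdist_perturb.
Qed.

End positive_mdim.

(** * Discontinuity from the two families of approximations *)

Theorem theorem4p7 (R : realType) (phi : C0 (@unit_interval_compact R)) :
  ~ continuous_at phi
      (fun psi : C0 (@unit_interval_compact R) => lower_mdim psi) /\
  ~ continuous_at phi
      (fun psi : C0 (@unit_interval_compact R) => upper_mdim psi).
Proof.
suff notcont (mdim : C0 (@unit_interval_compact R) -> \bar R) :
    (forall e : R, 0 < e -> exists2 psi, mdist phi psi <= e & (mdim psi <= 0)%E) ->
    (forall e : R, 0 < e ->
      exists2 psi, mdist phi psi <= e & ((4^-1)%:E <= mdim psi)%E) ->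
    ~ continuous_at phi mdim.
  split; apply: notcont => e e0.
  - by have [psi [? ? ?]] := mdim_le0_dense phi e0; exists psi.
  - by have [psi [? ? ?]] := mdim_ge4V_dense phi e0; exists psi.
  - by have [psi [? ? ?]] := mdim_le0_dense phi e0; exists psi.
  - by have [psi [? ? ?]] := mdim_ge4V_dense phi e0; exists psi.
move=> small large cont.
have ex (A : set (\bar R)) (P : set (C0 (@unit_interval_compact R))) :
    nbhs (mdim phi) A ->
    (forall e : R, 0 < e -> exists2 psi, mdist phi psi <= e & P psi) ->
    exists psi, A (mdim psi) /\ P psi.
  move=> /cont /nbhs_ballP[e /= e0 eA] Pe.
  have e20 : 0 < e / 2 by rewrite divr_gt0.
  have [psi psie Ppsi] := Pe _ e20; exists psi; split => //.
  by apply: eA; rewrite ballEmdist/=; apply: le_lt_trans psie _; rewrite gtr_pMr//; lra.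
(* The value [1/8] separates [0] from [1/4]: below it the maps of large dimension contradict
   continuity, otherwise those of dimension at most [0] do. *)
have [lt8|ge8] := ltP (mdim phi) (8^-1)%:E.
  have [psi [/= psi8]] := ex _ _ (open_ereal_lt' lt8) large.
  by move=> /le_lt_trans /(_ psi8); rewrite lte_fin; lra.
have gt0 : (0 < mdim phi)%E by apply: lt_le_trans ge8; rewrite lte_fin; lra.
have [psi [/= psi0]] := ex _ _ (open_ereal_gt' gt0) small.
by move=> /(lt_le_trans psi0); rewrite ltxx.
Qed.
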